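(* Let $G$ be a graph of twin-width at most $d$, $A$ be a subset of vertices of $G$, and $\varphi(\mathbf{x},\mathbf{y})$ be a first-order formula. Then $$|S^{\varphi}(A)|\leq \mathcal{O}_{d,\varphi}\left(|A|^{|\mathbf{y}|}\right).$$
   Context: The twin-width of $G$ is the minimum width of a contraction sequence of $G$ (a sequence of partitions from singletons to one part, merging two parts at each step; width is the maximum degree of the impurity graph on parts, where two parts are adjacent iff neither complete nor anti-complete). $\mathbf{x},\mathbf{y}$ are disjoint finite sets of variables, and the Stone space is $S^\varphi(A)\coloneqq \left\{\,\{\,\mathbf{a}\in A^{\mathbf{x}}~|~G\models \varphi(\mathbf{a},\mathbf{b})\,\}~\colon~\mathbf{b}\in V(G)^{\mathbf{y}}\,\right\}$, where $A^{\mathbf{x}}$ denotes functions from $\mathbf{x}$ to $A$. $\mathcal{O}_{d,\varphi}(\cdot)$ hides factors depending on $d$ and $\varphi$.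
   Formalization: The set A is assumed nonempty: for A empty and |y| ≥ 1 in a nonempty graph (with x nonempty), the Stone space has one element while |A|^|y| = 0, so the literal bound fails. *)

(* Defs.v *)
From mathcomp Require Import all_boot.
Set Implicit Arguments. Unset Strict Implicit. Unset Printing Implicit Defensive.

(* A finite simple graph is a symmetric irreflexive relation e : rel T on a finType T. *)

Section TwinWidth.
Variable (T : finType) (e : rel T).

Definition singletons : {set {set T}} := [set [set v] | v : T].

Definition impure (X Y : {set T}) : bool :=
  ~~ [forall u in X, forall v in Y, e u v] &&
  ~~ [forall u in X, forall v in Y, ~~ e u v].

Definition red_degree (P : {set {set T}}) (X : {set T}) : nat :=
  #|[set Y in P | (Y != X) && impure X Y]|.

Definition merge_step (P Q : {set {set T}}) : bool :=
  [exists X in P, exists Y in P,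
     (X != Y) && (Q == (X :|: Y) |: ((P :\ X) :\ Y))].

Definition width_le (d : nat) (P : {set {set T}}) : bool :=
  [forall X in P, red_degree P X <= d].

Definition contraction_seq (s : seq {set {set T}}) : bool :=
  path merge_step singletons s && (#|last singletons s| <= 1).

Definition tww_le (d : nat) : Prop :=
  exists s : seq {set {set T}},
    contraction_seq s /\ all (width_le d) (singletons :: s).
End TwinWidth.

Inductive formula : Type :=
  | FEq of nat & nat
  | FAdj of nat & nat
  | FTrue
  | FNot of formula
  | FAnd of formula & formula
  | FOr of formula & formula
  | FExists of nat & formula
  | FForall of nat & formula.

Fixpoint fv (f : formula) : seq nat :=
  match f with
  | FEq i j | FAdj i j => [:: i; j]
  | FTrue => [::]
  | FNot g => fv g
  | FAnd g h | FOr g h => fv g ++ fv h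
  | FExists i g | FForall i g => filter (fun j => j != i) (fv g)
  end.

(* satisfaction under a partial valuation (unassigned variables make atoms false;
   irrelevant when all free variables are assigned) *)
Fixpoint sat (T : finType) (e : rel T) (v : nat -> option T) (f : formula) : bool :=
  match f with
  | FEq i j => match v i, v j with Some a, Some b => a == b | _, _ => false end
  | FAdj i j => match v i, v j with Some a, Some b => e a b | _, _ => false end
  | FTrue => true
  | FNot g => ~~ sat e v g
  | FAnd g h => sat e v g && sat e v h
  | FOr g h => sat e v g || sat e v h
  | FExists i g => [exists a : T, sat e (fun j => if j == i then Some a else v j) g]
  | FForall i g => [forall a : T, sat e (fun j => if j == i then Some a else v j) g]
  end.

Definition env (T : finType) (x y : seq nat)
    (a : {ffun 'I_(size x) -> T}) (b : {ffun 'I_(size y) -> T}) (j : nat) : option T :=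
  match [pick i : 'I_(size x) | nth 0 x i == j] with
  | Some i => Some (a i)
  | None => match [pick i : 'I_(size y) | nth 0 y i == j] with
            | Some i => Some (b i)
            | None => None
            end
  end.

Definition stone (T : finType) (e : rel T) (phi : formula) (x y : seq nat)
    (A : {set T}) : {set {set {ffun 'I_(size x) -> T}}} :=
  [set [set a : {ffun 'I_(size x) -> T} |
          [forall i, a i \in A] && sat e (@env T x y a b) phi]
    | b : {ffun 'I_(size y) -> T}].

(* Main.v *)
Require Import Defs.
From mathcomp Require Import all_boot.
Set Implicit Arguments. Unset Strict Implicit. Unset Printing Implicit Defensive.

(** Two non-adjacent parts of a partition are homogeneous to each other, so in a
    partition whose impurity graph has bounded degree the Ehrenfeucht-Fraisse
    game is local: positions won on two sides that are far apart in the impurity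
    graph can be glued. Hence tuples inside boundedly many parts have boundedly
    many types.

    Along a contraction sequence distances only decrease, so each tuple b outside
    A has a last time at which it is far from A; afterwards some coordinate b_1 is
    close to some a in A. Let time run on until the set of elements of A close to
    a changes. A charging argument on representatives of the parts meeting A shows
    that only O(|A|) pairs (time, a) arise in this way. For each pair, the
    coordinates of b that are close to b_1 have boundedly many types over A: those
    close to a lie in few parts of the earlier partition, in which b was still far
    from them. So b can be replaced, without changing its type over A, by a tuple
    having a coordinate in a set R of size O(|A|). Adding that coordinate to A and
    inducting on the length of b gives O(|A|^|y|) types. *)

(** * Counting with finite sets *)

Lemma leq_card_bigcup (I T : finType) (S : {set I}) (F : I -> {set T}) (c : nat) :
  (forall i, i \in S -> #|F i| <= c) -> #|\bigcup_(i in S) F i| <= #|S| * c.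
Proof.
move=> Fc; rewrite -sum_nat_const.
apply: (@leq_trans (\sum_(i in S) #|F i|)); last exact: leq_sum.
elim/big_rec2: _ => [|i n B _ IH]; first by rewrite cards0.
by rewrite (leq_trans (leq_card_setU _ _)) // leq_add2l.
Qed.

(** One preimage is picked for each value of [g] on [W]. *)
Lemma transversal_image (U V : finType) (W : {set U}) (g : U -> V) :
  exists2 R : {set U}, R \subset W /\ #|R| <= #|g @: W|
    & forall u, u \in W -> exists2 u', u' \in R & g u' = g u.
Proof.
pose pk v : option U := [pick u in W | g u == v].
exists [set u | Some u \in pk @: (g @: W)].
  split.
    apply/subsetP=> u; rewrite inE => /imsetP[v _].
    by rewrite /pk; case: pickP => // w /andP[wW _] [->].
  apply: leq_trans (leq_imset_card pk _).
  rewrite -(card_imset _ (@Some_inj _)); apply: subset_leq_card.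
  by apply/subsetP=> o /imsetP[u]; rewrite inE => uP ->.
move=> u uW; have := erefl (pk (g u)); rewrite {1}/pk.
case: pickP => [w /andP[wW /eqP gw] eqw|/(_ u)]; last by rewrite uW eqxx.
exists w => //; rewrite inE; apply/imsetP; exists (g u); [exact: imset_f|].
exact: eqw.
Qed.

(** * Locality of the game *)

Section Locality.
Variables (T : finType) (e : rel T).
Hypothesis e_sym : symmetric e.
Implicit Types (f g : T -> {set T}) (z : seq (T * T)).

(* Partitions are represented by labellings of the vertices. *)
Definition block f u : {set T} := [set w | f w == f u].

(** Equal labels are included so that [near] describes closed balls in the impurity graph, which
    grow with the radius. *)
Definition adj f u v := (f u == f v) || impure e (block f u) (block f v).

Fixpoint near f r u v :=
  if r is r'.+1 then [exists w, near f r' u w && adj f w v] else f u == f v.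

Definition refines f g := forall u v, f u = f v -> g u = g v.

(** The extra unit counts the block of [u] itself. *)
Definition width_at_most f d := forall u, #|f @: [set v | adj f u v]| <= d.+1.

Lemma impureC (X Y : {set T}) : impure e X Y = impure e Y X.
Proof.
rewrite /impure; congr (~~ _ && ~~ _); apply/idP/idP => /forall_inP H;
  by apply/forall_inP => u uY; apply/forall_inP => v vX;
     rewrite e_sym; move/forall_inP: (H v vX) => /(_ u uY).
Qed.

Lemma impureS (X X' Y Y' : {set T}) :
  X \subset X' -> Y \subset Y' -> impure e X Y -> impure e X' Y'.
Proof.
move=> /subsetP sX /subsetP sY /andP[H1 H2].
apply/andP; split; [apply: contra H1|apply: contra H2] => /forall_inP H;
  by apply/forall_inP => u /sX/H /forall_inP Hu; apply/forall_inP => v /sY/Hu.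
Qed.

Lemma adjC f u v : adj f u v = adj f v u.
Proof. by rewrite /adj eq_sym impureC. Qed.

Lemma adj_eq f u u' v v' : f u = f u' -> f v = f v' -> adj f u v = adj f u' v'.
Proof. by move=> fu fv; rewrite /adj /block fu fv. Qed.

Lemma near_refl f r u : near f r u u.
Proof. by elim: r => //= r IH; apply/existsP; exists u; rewrite IH /adj eqxx. Qed.

Lemma near_eq f r u u' v v' :
  f u = f u' -> f v = f v' -> near f r u v = near f r u' v'.
Proof.
move=> fu; elim: r v v' => [|r IH] v v' fv /=; first by rewrite fu fv.
by apply: eq_existsb => w; rewrite (IH w w) // (adj_eq (erefl (f w)) fv).
Qed.

Lemma near1 f u v : near f 1 u v = adj f u v.
Proof.
apply/existsP/idP => [[w /andP[/= /eqP fuw]]|auv].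
  by rewrite (@adj_eq f w u v v).
by exists u; rewrite /= eqxx.
Qed.

Lemma near_trans f r q u v w : near f r u v -> near f q v w -> near f (r + q) u w.
Proof.
move=> uv; elim: q w => [|q IH] w /=.
  by move/eqP=> fvw; rewrite addn0 -(@near_eq f r u u v w).
case/existsP=> x /andP[vx xw]; rewrite addnS /=.
by apply/existsP; exists x; rewrite IH.
Qed.

Lemma nearC f r u v : near f r u v = near f r v u.
Proof.
suff: forall u v, near f r u v -> near f r v u by move=> H; apply/idP/idP; apply: H.
elim: r => [|r IH] {}u {}v /=; first by rewrite eq_sym.
case/existsP=> x /andP[/IH xu]; rewrite adjC -near1 => vx.
exact: (near_trans vx xu).
Qed.

Lemma near_leq f r q u v : r <= q -> near f r u v -> near f q u v.
Proof.
by move=> rq uv; rewrite -(subnKC rq); apply: near_trans uv (near_refl _ _ _).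
Qed.

(** Impurity passes to larger blocks, so a walk in the impurity graph of [f] maps to a walk in that
    of [g]. *)
Lemma near_refines f g r u v : refines f g -> near f r u v -> near g r u v.
Proof.
move=> fg; elim: r v => [|r IH] v /=; first by move/eqP/fg->.
case/existsP=> w /andP[/IH uw wv]; apply/existsP; exists w; rewrite uw /=.
case/orP: wv => [/eqP/fg gwv|wv]; first by rewrite /adj gwv eqxx.
by apply/orP; right; apply: impureS wv; apply/subsetP=> x; rewrite !inE => /eqP/fg gx; rewrite gx eqxx.
Qed.

Lemma card_near f d r u :
  width_at_most f d -> #|f @: [set v | near f r u v]| <= d.+1 ^ r.
Proof.
move=> fd; elim: r => [|r IH].
  apply: leq_trans (subset_leq_card (_ : _ \subset [set f u])) _; rewrite ?cards1 //.
  by apply/subsetP=> X /imsetP[v]; rewrite !inE => /eqP-> ->.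
pose nb X := f @: [set v | [exists w, (f w == X) && adj f w v]].
apply: leq_trans (_ : #|\bigcup_(X in f @: [set v | near f r u v]) nb X| <= _).
  apply/subset_leq_card/subsetP=> X /imsetP[v]; rewrite inE => /existsP[w /andP[uw wv]] ->.
  apply/bigcupP; exists (f w); first by apply: imset_f; rewrite inE.
  by apply: imset_f; rewrite inE; apply/existsP; exists w; rewrite eqxx.
rewrite expnSr; apply: leq_trans (leq_card_bigcup (c := d.+1) _) _; last by rewrite leq_mul2r IH orbT.
move=> X /imsetP[w _ ->]; apply: leq_trans (fd w); apply/subset_leq_card/imsetS.
by apply/subsetP=> v; rewrite !inE => /existsP[w' /andP[/eqP fw]]; rewrite (adj_eq fw (erefl (f v))).
Qed.

(* A position lists the pairs of chosen vertices; each reply has to stay in the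
   block of the move it answers. *)
Definition atom f z := forall p q, p \in z -> q \in z ->
  [/\ f p.1 = f p.2, (p.1 == q.1) = (p.2 == q.2) & e p.1 q.1 = e p.2 q.2].

Fixpoint game f k z : Prop :=
  if k is k'.+1 then
    (forall c, exists c', game f k' ((c, c') :: z)) /\
    (forall c', exists c, game f k' ((c, c') :: z))
  else atom f z.

Lemma sub_cons (S : eqType) (x : S) (s t : seq S) :
  {subset s <= t} -> {subset x :: s <= x :: t}.
Proof. by move=> st y; rewrite !inE => /orP[->//|/st->]; rewrite orbT. Qed.

Lemma game_sub f k z z' : {subset z <= z'} -> game f k z' -> game f k z.
Proof.
elim: k z z' => [|k IH] z z' zz' /=; first by move=> H p q /zz' pz /zz'; apply: H.
by move=> [H1 H2]; split=> c; [have [c' Hc] := H1 c|have [c' Hc] := H2 c];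
  exists c'; apply: IH Hc; apply: sub_cons.
Qed.

Lemma game_id f k z : (forall p, p \in z -> p.1 = p.2) -> game f k z.
Proof.
elim: k z => [|k IH] z zid /=; first by move=> p q /zid-> /zid->.
by split=> c; exists c; apply: IH => p; rewrite inE => /orP[/eqP->//|/zid].
Qed.

(** Play any vertex and forget the new pair; the empty position, where no vertex may be at hand, is
    won outright. *)
Lemma game_pred f k z : game f k.+1 z -> game f k z.
Proof.
case: z => [_|[a b] z [H _]]; first exact: game_id.
by have [c Hc] := H a; apply: game_sub Hc => p pz; rewrite inE pz orbT.
Qed.

Lemma game_atom f k z : game f k z -> atom f z.
Proof. by elim: k => // k IH /game_pred. Qed.

Definition swap (p : T * T) := (p.2, p.1).

Lemma game_swap f k z : game f k z -> game f k (map swap z).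
Proof.
elim: k z => [|k IH] z /=.
  move=> H p q /mapP[p' pz ->] /mapP[q' qz ->] /=.
  by have [-> -> ->] := H _ _ pz qz.
by move=> [H1 H2]; split=> c; [have [c' Hc] := H2 c|have [c' Hc] := H1 c];
  exists c'; have := IH _ Hc.
Qed.

Lemma game_refines f g k z : refines f g -> game f k z -> game g k z.
Proof.
move=> fg; elim: k z => [|k IH] z /=.
  by move=> H p q pz qz; have [/fg ? ? ?] := H p q pz qz.
by move=> [H1 H2]; split=> c; [have [c' Hc] := H1 c|have [c' Hc] := H2 c];
  exists c'; apply: IH.
Qed.

(** Strategies compose through a middle vertex; triples keep it in view of both games. *)
Lemma game_trans3 f k (t : seq (T * T * T)) :
  game f k [seq (x.1.1, x.1.2) | x <- t] -> game f k [seq (x.1.2, x.2) | x <- t] ->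
  game f k [seq (x.1.1, x.2) | x <- t].
Proof.
elim: k t => [|k IH] t /=.
  move=> H1 H2 p q /mapP[x xt ->] /mapP[y yt ->] /=.
  have [/= -> -> ->] := H1 _ _ (map_f (fun x => (x.1.1, x.1.2)) xt) (map_f _ yt).
  by have [/= -> -> ->] := H2 _ _ (map_f (fun x => (x.1.2, x.2)) xt) (map_f _ yt).
move=> [H1 H2] [H3 H4]; split=> c.
  have [c' Hc] := H1 c; have [c'' Hc'] := H3 c'; exists c''.
  exact: (IH ((c, c', c'') :: t)).
have [c' Hc] := H4 c; have [c'' Hc'] := H2 c'; exists c''.
exact: (IH ((c'', c', c) :: t)).
Qed.

Lemma game_trans f k (u v w : seq T) : size u = size v -> size v = size w ->
  game f k (zip u v) -> game f k (zip v w) -> game f k (zip u w).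
Proof.
move=> uv vw H1 H2; have := @game_trans3 f k (zip (zip u v) w).
have -> : [seq (x.1.1, x.1.2) | x <- zip (zip u v) w] = zip u v.
  rewrite -[RHS](@unzip1_zip _ _ (zip u v) w) ?size_zip ?uv ?minnn ?vw //.
  by apply: eq_map => -[[]].
have -> : [seq (x.1.2, x.2) | x <- zip (zip u v) w] = zip v w.
  by elim: u v w uv vw {H1 H2} => [|a u IH] [|b v] [|c w] //= [uv] [vw]; rewrite IH.
have -> : [seq (x.1.1, x.2) | x <- zip (zip u v) w] = zip u w.
  by elim: u v w uv vw {H1 H2} => [|a u IH] [|b v] [|c w] //= [uv] [vw]; rewrite IH.
by apply.
Qed.

Lemma game_zipC f k u v : size u = size v -> game f k (zip u v) -> game f k (zip v u).
Proof.
move=> uv /game_swap; congr game.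
by elim: u v uv => [|a u IH] [|b v] //= [uv]; rewrite IH.
Qed.

Lemma nonadj_homogeneous f u u' v v' : ~~ adj f u v ->
  f u = f u' -> f v = f v' -> e u v = e u' v'.
Proof.
rewrite /adj negb_or /impure negb_and !negbK => /andP[_ /orP[]] /forall_inP H fu fv.
  have Hu w x : f w = f u -> f x = f v -> e w x.
    move=> fw fx; have wu : w \in block f u by rewrite inE fw.
    by move/forall_inP: (H w wu); apply; rewrite inE fx.
  by rewrite !Hu.
have Hu w x : f w = f u -> f x = f v -> e w x = false.
  move=> fw fx; have wu : w \in block f u by rewrite inE fw.
  by apply: negbTE; move/forall_inP: (H w wu); apply; rewrite inE fx.
by rewrite !Hu.
Qed.

(* Spoiler's move is answered on the side to which it is close; the halved
   radius keeps the two sides far apart in the remaining rounds. *)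
Lemma game_cat f k z1 z2 : game f k z1 -> game f k z2 ->
  (forall p q, p \in z1 -> q \in z2 -> ~~ near f (2 ^ k) p.1 q.1) ->
  game f k (z1 ++ z2).
Proof.
elim: k z1 z2 => [|k IH] z1 z2.
  move=> H1 H2 far p q; rewrite !mem_cat => /orP[pz|pz] /orP[qz|qz].
  - exact: H1.
  - have [fp _ _] := H1 _ _ pz pz; have [fq _ _] := H2 _ _ qz qz.
    (* At radius 1 the two blocks are distinct and homogeneous to each other, so they determine
       equality and adjacency. *)
    have npq := far _ _ pz qz; rewrite near1 in npq.
    split=> //; last exact: nonadj_homogeneous npq fp fq.
    move: npq; rewrite /adj negb_or => /andP[npq _].
    have -> : (p.1 == q.1) = false by apply: contraNF npq => /eqP->.
    by symmetry; apply: contraNF npq => /eqP pq; rewrite fp fq pq.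
  - have [fp _ _] := H2 _ _ pz pz; have [fq _ _] := H1 _ _ qz qz.
    have npq := far _ _ qz pz; rewrite near1 in npq.
    split=> //; last by rewrite e_sym [RHS]e_sym; exact: nonadj_homogeneous npq fq fp.
    move: npq; rewrite /adj negb_or => /andP[npq _].
    have -> : (p.1 == q.1) = false by apply: contraNF npq => /eqP->.
    by symmetry; apply: contraNF npq => /eqP pq; rewrite fp fq pq.
  - exact: H2.
move=> G1 G2 far.
have fst1 p : p \in z1 -> f p.1 = f p.2 by move=> pz; have [] := game_atom G1 pz pz.
have fst2 p : p \in z2 -> f p.1 = f p.2 by move=> pz; have [] := game_atom G2 pz pz.
(* A move close to [z1] joins [z1]; every other move joins [z2], even if it is far from both. *)
have step c c' : f c = f c' ->
    (has (fun p => near f (2 ^ k) p.1 c) z1 -> game f k ((c, c') :: z1) ->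
      game f k ((c, c') :: z1 ++ z2)) /\
    (~~ has (fun p => near f (2 ^ k) p.1 c) z1 -> game f k ((c, c') :: z2) ->
      game f k ((c, c') :: z1 ++ z2)).
  move=> fc; split=> [/hasP[p pz pc]|/hasPn nz] H.
    rewrite -cat_cons; apply: IH => //; first exact: game_pred.
    move=> p' q; rewrite inE => /orP[/eqP->|p'z] qz /=.
      apply: contra (far _ _ pz qz) => cq; rewrite expnS mul2n -addnn.
      exact: near_trans pc cq.
    by apply: contra (far _ _ p'z qz); apply: near_leq; rewrite leq_pexp2l.
  apply: game_sub (IH z1 ((c, c') :: z2) _ H _); last 1 first.
  - move=> p q pz; rewrite inE => /orP[/eqP->/=|qz]; first exact: nz.
    by apply: contra (far _ _ pz qz); apply: near_leq; rewrite leq_pexp2l.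
  - by move=> x; rewrite !(inE, mem_cat) => /orP[->|/orP[->|->]]; rewrite ?orbT.
  - exact: game_pred.
have blockeq c c' z : game f k ((c, c') :: z) -> f c = f c'.
  by move/game_atom => /(_ (c, c') (c, c')); rewrite inE eqxx => /(_ isT isT)[].
have [H1 H1'] := G1; have [H2 H2'] := G2; split=> c.
  case: (boolP (has (fun p => near f (2 ^ k) p.1 c) z1)) => nc.
    by have [c' Hc] := H1 c; exists c'; apply: (step _ _ (blockeq _ _ _ Hc)).1.
  by have [c' Hc] := H2 c; exists c'; apply: (step _ _ (blockeq _ _ _ Hc)).2.
(* Here Spoiler plays on the second side. The reply shares the block of the move, so closeness to
   [z1] can be tested on either vertex. *)
have hasE c' : f c' = f c -> has (fun p => near f (2 ^ k) p.1 c') z1 = has (fun p => near f (2 ^ k) p.1 c) z1.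
  by move=> fc; apply: eq_has => p; apply: near_eq.
case: (boolP (has (fun p => near f (2 ^ k) p.1 c) z1)) => nc.
  have [c' Hc] := H1' c; exists c'.
  have fc := blockeq _ _ _ Hc; apply: (step _ _ fc).1 => //; by rewrite hasE.
have [c' Hc] := H2' c; exists c'.
have fc := blockeq _ _ _ Hc; apply: (step _ _ fc).2 => //; by rewrite hasE.
Qed.

(* Moves of Spoiler far from the position are copied. *)
Lemma game_local f k z : game f k z ->
  (forall c, has (fun p => near f (2 ^ k) p.1 c) z -> exists c', game f k ((c, c') :: z)) ->
  (forall c, has (fun p => near f (2 ^ k) p.1 c) z -> exists c', game f k ((c', c) :: z)) ->
  game f k.+1 z.
Proof.
move=> G H1 H2.
have far c : ~~ has (fun p => near f (2 ^ k) p.1 c) z -> game f k ((c, c) :: z).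
  move=> /hasPn nz; apply: (@game_sub f k _ (z ++ [:: (c, c)])).
    by move=> x; rewrite mem_cat !inE orbC.
  apply: game_cat => //; first by apply: game_id => p; rewrite inE => /eqP->.
  by move=> p q /nz np; rewrite inE => /eqP->.
split=> c; case: (boolP (has (fun p => near f (2 ^ k) p.1 c) z)) => nc;
  by [exact: H1|exact: H2|exists c; exact: far].
Qed.

End Locality.

(** * Boundedly many types *)

Lemma has_near_eq (T : finType) (e : rel T) f r (u u' : seq T) c :
  map f u = map f u' -> has (fun x => near e f r x c) u = has (fun x => near e f r x c) u'.
Proof.
elim: u u' => [|x u IH] [|x' u'] //= [fx /IH->].
by rewrite (near_eq _ _ fx (erefl (f c))).
Qed.

Lemma has_zip_fst (T : Type) (P : pred T) (u u' : seq T) : size u = size u' ->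
  has (fun p => P p.1) (zip u u') = has P u.
Proof. by elim: u u' => [|x u IH] [|x' u'] //= [/IH->]. Qed.

Lemma card_near_seq (T : finType) (e : rel T) f d r (u : seq T) :
  width_at_most e f d ->
  #|f @: [set c | has (fun x => near e f r x c) u]| <= size u * d.+1 ^ r.
Proof.
move=> fd; elim: u => [|x u IH] /=.
  by rewrite (_ : [set _ | _] = set0) ?imset0 ?cards0 //; apply/setP=> c; rewrite !inE.
rewrite (_ : [set _ | _] = [set c | near e f r x c] :|: [set c | has (fun x => near e f r x c) u]); last first.
  by apply/setP=> c; rewrite !inE.
rewrite imsetU mulSn; apply: leq_trans (leq_card_setU _ _) _.
by apply: leq_add => //; apply: card_near.
Qed.

(* By [game_local] the moves to be recorded lie in boundedly many blocks, so [K]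
   does not depend on the graph. *)
Lemma game_code d k n : exists K : finType,
  forall (T : finType) (e : rel T), symmetric e ->
  forall f, width_at_most e f d ->
  exists code : seq T -> K, forall u u', size u = n -> map f u = map f u' ->
    code u = code u' -> game e f k (zip u u').
Proof.
elim: k n => [|k IH] n.
  exists {ffun 'I_n * 'I_n -> bool * bool} => T e es f fd.
  (* The head of the sequence is the default of [nth]; the empty sequence gets a constant code. *)
  exists (fun u : seq T => if u is x0 :: _ then
    [ffun x : 'I_n * 'I_n => (nth x0 u x.1 == nth x0 u x.2, e (nth x0 u x.1) (nth x0 u x.2))]
    else [ffun => (true, true)]).
  move=> [|x u] [|x' u'] //; set v := x :: u; set v' := x' :: u'.
  move=> sv fv cv.
  have sv' : size v' = n by rewrite -(size_map f) -fv size_map.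
  have mem p : p \in zip v v' -> exists i : 'I_n, p = (nth x v i, nth x' v' i).
    move/(nthP (x, x')) => [i]; rewrite size_zip sv sv' minnn => ilt <-.
    by exists (Ordinal ilt); rewrite nth_zip ?sv ?sv'.
  move=> _ _ /mem[i ->] /mem[j ->] /=.
  have := congr1 (fun g : {ffun _ -> _} => g (i, j)) cv; rewrite !ffunE /= => -[-> ->].
  split=> //; rewrite -(nth_map x set0) ?sv // fv.
  by rewrite (nth_map x') ?sv'.
have [K1 H1] := IH n; have [K2 H2] := IH n.+1.
pose D := n * d.+1 ^ (2 ^ k).
exists (K1 * {set 'I_D.+1 * K2})%type => T e es f fd.
have [c1 {}H1] := H1 T e es f fd; have [c2 {}H2] := H2 T e es f fd.
(* Labels vary with [T], so a block is named by its index in [Bl u]. This list depends only on the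
   labels of [u], so the names agree for [u] and [u']. *)
pose Bl u := enum (f @: [set c | has (fun x => near e f (2 ^ k) x c) u]).
exists (fun u => (c1 u, [set x : 'I_D.+1 * K2 | [exists c, [&& f c \in Bl u,
  index (f c) (Bl u) == x.1 & c2 (c :: u) == x.2]]])).
move=> u u' su fu [cu cu2].
have su' : size u = size u' by rewrite -(size_map f) fu size_map.
have BlE : Bl u' = Bl u.
  rewrite /Bl; suff -> : [set c | has (fun x => near e f (2 ^ k) x c) u'] =
    [set c | has (fun x => near e f (2 ^ k) x c) u] by [].
  by apply/setP=> c; rewrite !inE; apply/esym/has_near_eq.
have mBl c : has (fun x => near e f (2 ^ k) x c) u -> f c \in Bl u.
  by move=> hc; rewrite mem_enum; apply: imset_f; rewrite inE.
have iBl X : X \in Bl u -> index X (Bl u) < D.+1.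
  rewrite -index_mem -cardE => /leq_trans; apply.
  by apply: leq_trans (card_near_seq _ _ fd) _; rewrite su.
apply: (game_local es); first exact: H1.
  move=> c; rewrite (has_zip_fst (fun x => near e f (2 ^ k) x c)) // => /mBl cB.
  have := congr1 (fun S : {set _} => (Ordinal (iBl _ cB), c2 (c :: u)) \in S) cu2.
  rewrite !inE (_ : [exists _, _] = true); last by apply/existsP; exists c; rewrite cB !eqxx.
  move/esym/existsP=> [c' /and3P[/= c'B /eqP ic /eqP cc]].
  rewrite BlE in c'B ic; have fc : f c' = f c by rewrite -(nth_index set0 c'B) ic nth_index.
  by exists c'; apply: (H2 (c :: u) (c' :: u')); rewrite /= ?su ?fc ?fu.
move=> c; rewrite (has_zip_fst (fun x => near e f (2 ^ k) x c)) // => /mBl cB.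
have := congr1 (fun S : {set _} => (Ordinal (iBl _ cB), c2 (c :: u')) \in S) cu2.
rewrite !inE [RHS](_ : [exists _, _] = true); last first.
  by apply/existsP; exists c; rewrite BlE cB !eqxx.
move/existsP=> [c' /and3P[/= c'B /eqP ic /eqP cc]].
have fc : f c' = f c by rewrite -(nth_index set0 c'B) ic nth_index.
by exists c'; apply: (H2 (c' :: u) (c :: u')); rewrite /= ?su ?fc ?fu.
Qed.

(** A tuple is classified by its sequence of labels, with at most [D ^ n] values, and by its code in
    [K]; tuples of one class win against each other. *)
Lemma game_representatives d k D n : exists C, forall (T : finType) (e : rel T),
  symmetric e -> forall f, width_at_most e f d ->
  forall (B : {set T}) (W : {set n.-tuple T}), #|f @: B| <= D ->
  (forall u : n.-tuple T, u \in W -> {subset u <= B}) ->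
  exists2 R : {set n.-tuple T}, R \subset W /\ #|R| <= C
    & forall u, u \in W -> exists2 u', u' \in R & game e f k (zip u u').
Proof.
have [K HK] := game_code d k n; exists (D ^ n * #|K|) => T e es f fd B W fB WB.
have [code Hc] := HK T e es f fd.
pose g (u : n.-tuple T) := ([ffun i => f (tnth u i)] : {ffun 'I_n -> {set T}}, code u).
have [R [RW Rc] HR] := transversal_image W g; exists R.
  split=> //; apply: leq_trans Rc _.
  pose F := [set h : {ffun 'I_n -> {set T}} | h \in ffun_on (f @: B)].
  apply: (@leq_trans #|setX F [set: K]|).
    apply/subset_leq_card/subsetP=> _ /imsetP[u uW ->]; rewrite !inE /= andbT.
    by apply/ffun_onP=> i; rewrite ffunE; apply/imset_f/(WB _ uW)/mem_tnth.
  rewrite cardsX cardsT leq_mul2r; apply/orP; right.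
  by rewrite cardsE card_ffun_on card_ord; case: (n) => // n'; rewrite leq_exp2r.
move=> u /HR[u' u'R [gf gc]]; exists u' => //.
apply: Hc; rewrite ?size_tuple //.
apply: (@eq_from_nth _ set0); rewrite ?size_map ?size_tuple // => i ilt.
have := congr1 (fun h : {ffun _ -> _} => h (Ordinal ilt)) gf.
rewrite !ffunE => E; rewrite !(nth_map (tnth u (Ordinal ilt))) ?size_tuple //.
by rewrite -!(tnth_nth _ _ (Ordinal ilt)).
Qed.

(* Pigeonhole: each element of [xs] lies in at most one annulus of width [s]. *)
Lemma empty_annulus (T : finType) (e : rel T) f (b : T) (xs : seq T) r0 s :
  exists2 i, i <= size xs & forall x, x \in xs ->
    near e f (r0 + i.+1 * s) b x -> near e f (r0 + i * s) b x.
Proof.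
pose P i := all (fun x => near e f (r0 + i.+1 * s) b x ==> near e f (r0 + i * s) b x) xs.
case: (boolP (has P (iota 0 (size xs).+1))) => [/hasP[i]|/hasPn nP].
  rewrite mem_iota /= add0n ltnS => ile /allP H; exists i => // x xxs.
  exact/implyP/H.
(* If no annulus is empty, each one adds an element of [xs], and the last ball holds more entries
   than [xs] has. *)
have count_ge i : i <= (size xs).+1 -> i <= count (near e f (r0 + i * s) b) xs.
  elim: i => // i IH ilt; apply: leq_trans (_ : (count (near e f (r0 + i * s) b) xs).+1 <= _).
    by rewrite ltnS IH // ltnW.
  have /nP/allPn[x xxs] : i \in iota 0 (size xs).+1 by rewrite mem_iota.
  rewrite negb_imply => /andP[xo xi].
  set a := near e f (r0 + i * s) b; set a' := near e f (r0 + i.+1 * s) b.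
  have := count_predUI a (predI a' (predC a)) xs.
  rewrite (@eq_count _ (predU _ _) a') => [|y /=].
    rewrite (@eq_count _ (predI _ _) pred0) => [|y /=]; last by rewrite andbC -andbA andNb andbF.
    rewrite count_pred0 addn0 => ->; rewrite -addn1 leq_add2l -has_count.
    by apply/hasP; exists x => //=; rewrite /a' xo.
  case: (boolP (a y)) => ay /=; last by rewrite andbT.
  by apply/esym/(near_leq _ ay); rewrite leq_add2l leq_mul2r leqnSn orbT.
have := leq_trans (count_ge _ (leqnn _)) (count_size _ _).
by rewrite ltnn.
Qed.

(** * Sequences of coarser and coarser partitions *)

(** Two singletons are always homogeneous. So at time 0 a vertex outside [A] is far from [A] at
    every radius. *)
Lemma adj_injective (T : finType) (e : rel T) (f : T -> {set T}) u v :
  injective f -> adj e f u v -> u = v.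
Proof.
move=> fI /orP[/eqP/fI//|].
have bl w : block f w = [set w].
  by apply/setP=> x; rewrite !inE; apply/eqP/eqP => [/fI|->].
rewrite !bl /impure => /andP[/negP H1 /negP H2].
have H (P : rel T) : P u v -> [forall x in [set u], forall y in [set v], P x y].
  by move=> Puv; apply/forall_inP=> x /set1P->; apply/forall_inP=> y /set1P->.
by case: (boolP (e u v)) => euv; [case: H1; apply: (H e)|case: H2; apply: (H (fun x y => ~~ e x y))].
Qed.

Lemma near_injective (T : finType) (e : rel T) (f : T -> {set T}) r u v :
  injective f -> near e f r u v -> u = v.
Proof.
move=> fI; elim: r v => [|r IH] v /=; first by move/eqP/fI.
by case/existsP=> w /andP[/IH-> /(adj_injective fI)].
Qed.

Section Coarsening.
Variables (T : finType) (e : rel T) (d : nat) (F : nat -> T -> {set T}) (N : nat).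

(** The fourth clause is what remains of merging two parts at a time: going back one step at most
    doubles a number of blocks. All times in [nat] are allowed, so [F t.+1] needs no bound on
    [t]. *)
Definition coarsening :=
  [/\ injective (F 0), forall t, refines (F t) (F t.+1),
      forall t, width_at_most e (F t) d,
      forall t u, #|F t @: [set v | F t.+1 v == F t.+1 u]| <= 2
    & forall u v, F N u = F N v].

Hypothesis e_sym : symmetric e.
Hypothesis Fc : coarsening.
Variable A : {set T}.

Lemma coarsening_refines s t : s <= t -> refines (F s) (F t).
Proof.
case: Fc => _ FS _ _ _ /subnKC<-; elim: (t - s) => [|n IH] u v; rewrite ?addn0 ?addnS //.
by move/IH/FS.
Qed.

Lemma coarsening_near s t r u v : s <= t -> near e (F s) r u v -> near e (F t) r u v.
Proof. by move/coarsening_refines; apply: near_refines. Qed.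

Lemma card_imset_coarsening t (B : {set T}) : #|F t @: B| <= 2 * #|F t.+1 @: B|.
Proof.
case: Fc => _ _ _ F2 _.
pose G X := F t @: [set v | F t.+1 v == X].
apply: (@leq_trans #|\bigcup_(X in F t.+1 @: B) G X|).
  apply/subset_leq_card/subsetP=> _ /imsetP[v vB ->]; apply/bigcupP.
  by exists (F t.+1 v); apply: imset_f; rewrite ?inE.
by rewrite mulnC; apply: leq_card_bigcup => _ /imsetP[u _ ->]; apply: F2.
Qed.

(** Choosing by least [enum_rank] makes the choices nested in time: an element that stops being a
    leader never becomes one again. *)
Definition leaders t := [set a in A | [forall a' in A,
  (F t a' == F t a) ==> (enum_rank a <= enum_rank a')]].

Lemma leaderP t a : a \in A -> exists2 a', a' \in leaders t & F t a' = F t a.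
Proof.
move=> aA; pose P x := (x \in A) && (F t x == F t a).
have Pa : P a by rewrite /P aA eqxx.
case: (arg_minnP (fun x : T => enum_rank x : nat) Pa) => x /andP[xA /eqP Fx] xmin.
exists x => //; rewrite inE xA; apply/forall_inP=> y yA; apply/implyP=> /eqP Fy.
by apply: xmin; rewrite /P yA Fy Fx eqxx.
Qed.

Lemma leadersS s t : s <= t -> leaders t \subset leaders s.
Proof.
move=> st; apply/subsetP=> a; rewrite !inE => /andP[-> /forall_inP H].
apply/forall_inP=> a' /H /implyP{}H; apply/implyP=> /eqP E; apply: H.
by apply/eqP/(coarsening_refines st).
Qed.

Lemma leaders_inj t : {in leaders t &, injective (F t)}.
Proof.
move=> a b; rewrite !inE => /andP[aA /forall_inP Ha] /andP[bA /forall_inP Hb] E.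
apply: enum_rank_inj; apply/val_inj/eqP; rewrite eqn_leq.
by move/implyP: (Ha b bA) => ->; rewrite ?E // ; move/implyP: (Hb a aA) => ->; rewrite ?E.
Qed.

Definition neighbors L t a := [set a' in A | near e (F t) L a a'].

Lemma neighborsS L s t a : s <= t -> neighbors L s a \subset neighbors L t a.
Proof.
move=> st; apply/subsetP=> x; rewrite !inE => /andP[-> /=].
exact: coarsening_near.
Qed.

Lemma neighbors_eq L t a b : F t a = F t b -> neighbors L t a = neighbors L t b.
Proof. by move=> E; apply/setP=> x; rewrite !inE (near_eq e L E (erefl (F t x))). Qed.

(** An element of [A] is a leader at time 0, so for it the maximum is attained; the value 0 of an
    empty maximum occurs only outside [A]. *)
Definition death a := \max_(t < N.+1 | a \in leaders t) t.

Lemma leq_death a t : t <= N -> a \in leaders t -> t <= death a.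
Proof.
move=> tN at_.
exact: (@leq_bigmax_cond _ (fun t : 'I_N.+1 => a \in leaders t) (fun t => t : nat) (Ordinal (tN : t < N.+1))).
Qed.

Lemma leader_death a : a \in A -> a \in leaders (death a).
Proof.
move=> aA; have a0 : a \in leaders 0.
  have [a' a'0] := leaderP 0 aA; case: Fc => F0 _ _ _ _ /F0 <- //.
have : 0 < #|[pred t : 'I_N.+1 | a \in leaders t]| by apply/card_gt0P; exists ord0.
case/(eq_bigmax_cond (fun t : 'I_N.+1 => t : nat)) => t0 ht0.
by rewrite /death (eq_bigl (mem [pred t : 'I_N.+1 | a \in leaders t])) // => ->.
Qed.

(* A pair of leaders that gets close is charged to the member that first stops
   being a leader. *)
Definition charged L a := [set a' in leaders (death a) | near e (F (death a).+1) L a a'].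

(** At time [(death a).+1] the ball about [a] has at most [d.+1 ^ L] blocks; one step earlier these
    are at most twice as many, each with at most one leader. *)
Lemma card_charged L a : #|charged L a| <= 2 * d.+1 ^ L.
Proof.
rewrite -(card_in_imset (f := F (death a))); last first.
  by move=> x y /setIdP[xl _] /setIdP[yl _]; apply: leaders_inj.
apply: leq_trans (card_imset_coarsening _ _) _; rewrite leq_mul2l /=.
case: Fc => _ _ Fw _ _; apply: leq_trans (card_near L a (Fw (death a).+1)).
by apply/subset_leq_card/imsetS/subsetP=> x; rewrite !inE => /andP[].
Qed.

(** Closeness persists once attained, so the moment at which a pair becomes close is a function of
    the pair, and counting pairs counts moments. *)
Definition last_far L a a' := \max_(t < N.+1 | ~~ near e (F t) L a a') t.

Lemma last_farE L a a' t : t < N -> ~~ near e (F t) L a a' ->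
  near e (F t.+1) L a a' -> last_far L a a' = t.
Proof.
move=> tN far nr; apply/eqP; rewrite eqn_leq; apply/andP; split.
  apply/bigmax_leqP=> i; rewrite leqNgt; apply: contra => ti.
  exact: coarsening_near nr.
exact: (@leq_bigmax_cond _ (fun t : 'I_N.+1 => ~~ near e (F t) L a a')
  (fun t => t : nat) (Ordinal (ltnW tN : t < N.+1))).
Qed.

(** Let [s] be the last time up to [N] at which the neighbours of [a] are still those at [t.+1].
    Either [s = N], or some [a'] becomes close to [a] right after [s]; then so do the leaders of
    their blocks at time [s], and [last_far] recovers [s] from this pair. *)
Lemma centers L : exists2 Z : {set 'I_N.+1 * T},
  #|Z| <= (4 * d.+1 ^ L).+1 * #|A| /\ (forall z, z \in Z -> z.2 \in A)
  & forall t a, a \in A -> t < N -> exists2 z, z \in Z &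
      [/\ t < z.1, F z.1 z.2 = F z.1 a & neighbors L z.1 z.2 = neighbors L t.+1 a].
Proof.
(* [Z0] serves the case [s = N]. [Z1] and [Z2] serve a charged pair, the center being the member
   that carries the charge or the other one. *)
pose Z0 := [set (@ord_max N, a) | a in A].
pose Z1 := \bigcup_(a in A) [set (inord (last_far L a a') : 'I_N.+1, a) | a' in charged L a].
pose Z2 := \bigcup_(a in A) [set (inord (last_far L a a') : 'I_N.+1, a') | a' in charged L a].
exists (Z0 :|: Z1 :|: Z2).
  split.
    have bound (g : T -> T -> 'I_N.+1 * T) :
        #|\bigcup_(a in A) [set g a a' | a' in charged L a]| <= #|A| * (2 * d.+1 ^ L).
      apply: leq_card_bigcup => a _.
      exact: leq_trans (leq_imset_card _ _) (card_charged L a).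
    apply: leq_trans (leq_card_setU _ _) _.
    have -> : (4 * d.+1 ^ L).+1 * #|A| = #|A| + #|A| * (2 * d.+1 ^ L) + #|A| * (2 * d.+1 ^ L).
      by rewrite mulSn -addnA -mulnDr -mulnDl mulnC.
    rewrite leq_add ?bound //; apply: leq_trans (leq_card_setU _ _) _.
    by rewrite leq_add ?bound // leq_imset_card.
  move=> z; rewrite !in_setU => /orP[/orP[]|].
  - by case/imsetP=> a aA ->.
  - by case/bigcupP=> a aA /imsetP[a' _ ->].
  - by case/bigcupP=> a aA /imsetP[a' + ->]; rewrite !inE => /andP[/andP[]].
move=> t a aA tN.
pose P s := (s <= N) && (neighbors L s a == neighbors L t.+1 a).
have Pt : exists s, P s by exists t.+1; rewrite /P tN eqxx.
have PN s : P s -> s <= N by case/andP.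
case: (ex_maxnP Pt PN) => s /andP[sN /eqP sa] smax.
have ts : t < s by apply: smax; rewrite /P tN eqxx.
move: sN; rewrite leq_eqVlt => /orP[/eqP sN|sN].
  exists (ord_max, a); last by rewrite /= -sN.
  by rewrite !in_setU imset_f.
have /subsetPn[a' a'1 a'0] : ~~ (neighbors L s.+1 a \subset neighbors L s a).
  apply/negP=> sub; suff : s < s by rewrite ltnn.
  apply: smax; rewrite /P sN -sa eqEsubset sub; exact/neighborsS/leqnSn.
move: a'1 a'0; rewrite !inE => /andP[a'A nr]; rewrite a'A /= => far.
have [l ll Fl] := leaderP s aA; have [l' ll' Fl'] := leaderP s a'A.
rewrite -(near_eq e L Fl Fl') in far.
have FSl : F s.+1 l = F s.+1 a by apply: (coarsening_refines (leqnSn s)).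
have FSl' : F s.+1 l' = F s.+1 a' by apply: (coarsening_refines (leqnSn s)).
rewrite -(near_eq e L FSl FSl') in nr.
have lA : l \in A by move: ll; rewrite inE => /andP[].
have l'A : l' \in A by move: ll'; rewrite inE => /andP[].
have sE : (inord s : 'I_N.+1) = s :> nat by rewrite inordK // ltnS ltnW.
exists (inord s, l); last by rewrite /= sE ts Fl (neighbors_eq _ Fl).
rewrite !in_setU; case: (leqP (death l) (death l')) => dl.
  apply/orP; left; apply/orP; right; apply/bigcupP; exists l => //.
  rewrite -(last_farE sN far nr); apply: (imset_f (fun a' => (inord (last_far L l a') : 'I_N.+1, l))).
  rewrite inE (subsetP (leadersS dl)) ?leader_death //=.
  by apply: coarsening_near nr; rewrite ltnS leq_death // ltnW.
apply/orP; right; apply/bigcupP; exists l' => //.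
rewrite (nearC e_sym) in far; rewrite (nearC e_sym) in nr.
rewrite -(last_farE sN far nr); apply: (imset_f (fun a' => (inord (last_far L l' a') : 'I_N.+1, a'))).
rewrite inE (subsetP (leadersS (ltnW dl))) ?leader_death //=.
by apply: coarsening_near nr; rewrite ltnS leq_death // ltnW.
Qed.

End Coarsening.

(** * Replacing tuples by representatives *)

Lemma mem_zip_fst (S T : eqType) (u : seq S) (v : seq T) p : p \in zip u v -> p.1 \in u.
Proof.
elim: u v => [|x u IH] [|y v] //=; rewrite !inE.
by case/orP=> [/eqP->|/IH->]; rewrite ?eqxx ?orbT.
Qed.

Lemma mem_zip_diag (T : eqType) (u : seq T) p : (p \in zip u u) = (p.1 == p.2) && (p.1 \in u).
Proof.
case: p => a b /=; elim: u => [|x u IH] /=; first by rewrite andbF.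
rewrite !inE IH xpair_eqE andb_orr; case: (a =P b) => [->|ab] /=; first by rewrite andbb.
by rewrite orbF; apply/negbTE/negP=> /andP[/eqP ax /eqP bx]; apply: ab; rewrite ax bx.
Qed.

(* The elements of A close to c at time t lie in few blocks at time s, so their
   l-tuples have boundedly many types there. A tuple w that is far from A at time s
   cannot distinguish l-tuples of the same type, so it suffices to compare w with
   w' over representatives of these types (the list [A1] below). *)
Lemma center_representatives d k n l L : exists C,
  forall (T : finType) (e : rel T), symmetric e ->
  forall F N, coarsening e d F N -> forall (A : {set T}) t c, c \in A ->
  exists2 R : {set T}, #|R| <= C & forall s w, s <= t ->
    #|F s @: neighbors e F A L t c| <= 2 * d.+1 ^ L -> size w = n ->
    (forall x, x \in w -> near e (F t) L c x /\
      forall a, a \in A -> ~~ near e (F s) (2 ^ k) x a) ->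
    exists w', [/\ size w' = n, {subset w' <= R} &
      forall u, size u = l -> {subset u <= neighbors e F A L t c} ->
        game e (F t) k (zip (w ++ u) (w' ++ u))].
Proof.
have [C1 HC1] := game_representatives d k (2 * d.+1 ^ L) l.
have [C2 HC2] := game_representatives d k (d.+1 ^ L) (n + l * C1).
exists (C2 * n) => T e es F N Fc A t c cA; have [_ _ Fw _ _] := Fc.
set B := neighbors e F A L t c.
have cB : c \in B by rewrite inE cA near_refl.
pose P s := (s <= t) && (#|F s @: B| <= 2 * d.+1 ^ L).
case: (boolP [exists s : 'I_t.+1, P s]) => [/existsP exP|/existsPn nP]; last first.
  exists set0; rewrite ?cards0 // => s w st Bs.
  by have := nP (inord s); rewrite /P inordK ?ltnS // st Bs.
have exP' : exists s, P s by case: exP => s Ps; exists s.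
(* Distances only decrease, so a tuple far from [A] at an eligible time is also far at the least
   one, [s0], which therefore serves all [s] at once. *)
case: (ex_minnP exP') => s0 /andP[s0t Bs0] s0min {exP exP'}.
pose W1 := [set u : l.-tuple T | all (mem B) u].
have W1B u : u \in W1 -> {subset u <= B} by rewrite inE => /allP.
have [R1 [R1sub R1c] HR1] := HC1 T e es (F s0) (Fw s0) B W1 Bs0 W1B.
have fsz : size (flatten [seq val u | u <- enum R1]) = #|R1| * l.
  rewrite size_flatten /shape -map_comp (eq_map (g := fun=> l)) => [|u /=]; last exact: size_tuple.
  by rewrite cardE; elim: (enum R1) => //= u r ->.
(* Padding with [c] gives [w ++ A1] a fixed length. *)
pose A1 := flatten [seq val u | u <- enum R1] ++ nseq (l * C1 - #|R1| * l) c.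
have A1sz : size A1 == l * C1.
  by rewrite size_cat fsz size_nseq subnKC // mulnC leq_mul2l R1c orbT.
have A1B : {subset A1 <= B}.
  move=> x; rewrite mem_cat => /orP[/flattenP[_ /mapP[u uR ->]]|/nseqP[-> _] //].
  by rewrite mem_enum in uR; have := subsetP R1sub _ uR; rewrite inE => /allP; apply.
have R1A1 u : u \in R1 -> {subset u <= A1}.
  move=> uR x xu; rewrite mem_cat; apply/orP; left; apply/flattenP; exists (val u) => //.
  by rewrite map_f // mem_enum.
clearbody A1.
pose B2 := [set x | near e (F t) L c x].
pose far w := all (fun x => (x \in B2) && [forall a in A, ~~ near e (F s0) (2 ^ k) x a]) w.
pose W2 := [set u : (n + l * C1).-tuple T | far (take n u) && (drop n u == A1)].
have [] := HC2 T e es (F t) (Fw t) B2 W2 (card_near L c (Fw t)).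
  move=> u; rewrite inE => /andP[/allP ufar /eqP udrop] x.
  rewrite -[x \in u]/(x \in tval u) -(cat_take_drop n u) mem_cat => /orP[/ufar/andP[]//|].
  by rewrite udrop => /A1B; rewrite !inE => /andP[].
move=> R2 [R2sub R2c] HR2.
exists (\bigcup_(u in R2) [set x in take n u]).
  apply: leq_trans (_ : #|R2| * n <= _); last by rewrite leq_mul2r R2c orbT.
  apply: leq_card_bigcup => u _; rewrite cardsE; apply: leq_trans (card_size _) _.
  by rewrite size_take size_tuple; case: ltnP.
move=> s w st Bs wn wP.
have s0s : s0 <= s by apply: s0min; rewrite /P st Bs.
have wfar : far w.
  apply/allP=> x /wP[xL xA]; rewrite inE xL; apply/forall_inP=> a /xA.
  by apply: contra; apply: (coarsening_near Fc s0s).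
have wA1sz : size (w ++ A1) == n + l * C1 by rewrite size_cat wn (eqP A1sz).
have [|u uR2 Hu] := HR2 (Tuple wA1sz).
  by rewrite inE /= take_size_cat // drop_size_cat // wfar eqxx.
have := subsetP R2sub _ uR2; rewrite inE => /andP[ufar /eqP udrop].
set w' := take n u in ufar.
have uE : val u = w' ++ A1 by rewrite -udrop cat_take_drop.
have w'n : size w' = n by rewrite size_takel // size_tuple leq_addr.
rewrite /= uE in Hu.
exists w'; split=> // [x xw'|v vl vB].
  by apply/bigcupP; exists u => //; rewrite inE.
have vsz : size v == l by rewrite vl.
have [|v' v'R Hv] := HR1 (Tuple vsz); first by rewrite inE; apply/allP.
have v'A1 := R1A1 _ v'R; rewrite /= in Hv.
have v'l : size v' = l := size_tuple v'.
have swap_far x y z : far x -> size y = l -> size z = l -> {subset y <= B} ->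
    game e (F s0) k (zip y z) -> game e (F t) k (zip (x ++ y) (x ++ z)).
  move=> /allP xfar yl zl yB G; apply: game_refines (coarsening_refines Fc s0t) _.
  rewrite zip_cat //; apply: game_cat => //.
    by apply: game_id => p; rewrite mem_zip_diag => /andP[/eqP].
  move=> p q; rewrite mem_zip_diag => /andP[_ /xfar/andP[_ /forall_inP H]] /mem_zip_fst/yB.
  by rewrite inE => /andP[/H].
(* The chain is [w ++ v], [w ++ v'], [w' ++ v'], [w' ++ v]. The outer links hold since [w] and [w']
   are far from [A] at time [s0], the middle one since the entries of [v'] occur in [A1]. *)
apply: (@game_trans _ _ _ _ _ (w ++ v')); rewrite ?size_cat ?wn ?w'n ?vl ?v'l //.
  exact: swap_far.
apply: (@game_trans _ _ _ _ _ (w' ++ v')); rewrite ?size_cat ?wn ?w'n ?vl ?v'l //.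
  apply: game_sub Hu; rewrite !zip_cat ?wn ?w'n // => p; rewrite !mem_cat => /orP[->//|].
  by rewrite !mem_zip_diag => /andP[-> /v'A1->]; rewrite orbT.
apply: swap_far => //; last by apply: game_zipC; rewrite ?vl.
by move=> x /v'A1/A1B.
Qed.

(** Only the coordinates satisfying [P] are exchanged. The others are masked by [b0] in the tuple
    matched with [w], and stay paired with themselves. *)
Lemma mem_zip_mix (T : eqType) (P : pred T) (b0 : T) (b w : seq T) p : size b = size w ->
  p \in zip b [seq if P q.1 then q.2 else q.1 | q <- zip b w] ->
  if P p.1 then p \in zip [seq if P x then x else b0 | x <- b] w else p.1 == p.2.
Proof.
elim: b w => [|x b IH] [|y w] //= [/IH{}IH]; rewrite !inE => /orP[/eqP->/=|/IH].
  by case: (P x); rewrite /= eqxx.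
by case: ifP => // _ ->; rewrite orbT.
Qed.

Lemma exchange d k m l : exists C, forall (T : finType) (e : rel T), symmetric e ->
  forall F N, coarsening e d F N -> forall A : {set T}, A != set0 ->
  exists2 R : {set T}, #|R| <= C * #|A| & forall b : seq T, size b = m.+1 ->
    exists b', [/\ size b' = m.+1, has (mem R) b' &
      forall u, size u = l -> {subset u <= A} -> game e (F N) k (zip (b ++ u) (b' ++ u))].
Proof.
(* [s] is the gap that gluing requires. [rho] has room for [l.+1] annuli of width [s], one more than
   [u] has entries; [L] has room for the distance [s] from [c] to [b1] and for [m.+2] annuli of
   width [rho], one more than [b] has entries. *)
pose s := 2 ^ k; pose rho := l.+1 * s; pose L := s + m.+2 * rho.
have [C HC] := center_representatives d k m.+1 l L.
exists ((4 * d.+1 ^ L).+1 * C).+1 => T e es F N Fc A /set0Pn[a0 a0A].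
have [F0 _ Fw _ FN] := Fc.
have [Z [Zc ZA] HZ] := centers es Fc A L.
(* The guard [z.2 \in A] allows a set to be chosen for every [z] of the finite type at once. *)
pose good (z : 'I_N.+1 * T) (R : {set T}) := z.2 \in A -> #|R| <= C /\
    forall s0 w, s0 <= z.1 -> #|F s0 @: neighbors e F A L z.1 z.2| <= 2 * d.+1 ^ L ->
    size w = m.+1 -> (forall x, x \in w -> near e (F z.1) L z.2 x /\
      forall a, a \in A -> ~~ near e (F s0) (2 ^ k) x a) ->
    exists w', [/\ size w' = m.+1, {subset w' <= R} &
      forall u, size u = l -> {subset u <= neighbors e F A L z.1 z.2} ->
        game e (F z.1) k (zip (w ++ u) (w' ++ u))].
have [Rz HRz] : exists Rz, forall z, good z (Rz z).
  apply: fin_all_exists => z; rewrite /good.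
  case: (boolP (z.2 \in A)) => zA; last by exists set0.
  by have [R Rc HR] := HC T e es F N Fc A z.1 z.2 zA; exists R.
exists (A :|: \bigcup_(z in Z) Rz z).
  apply: leq_trans (leq_card_setU _ _) _; rewrite mulSn leq_add2l.
  apply: leq_trans (leq_card_bigcup (c := C) _) _.
    by move=> z /ZA/HRz[].
  by rewrite mulnAC leq_mul2r Zc orbT.
move=> b bm; case: (boolP (has (mem A) b)) => [bA|/hasPn bA].
  exists b; split=> //.
    by apply: sub_has bA => x /=; rewrite inE => ->.
  by move=> u _ _; apply: game_id => p; rewrite mem_zip_diag => /andP[/eqP].
(* [b1] is the first coordinate to come close to [A], namely at time [t.+1]. The
   center [c] stands for [a] at the later time [r], and the coordinates within
   [j * rho] of [b1] at that time are exchanged together. *)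
pose close t := has (fun x => [exists a in A, near e (F t) s x a]) b.
have closeN : close N.
  case: b bm @close {bA} => // x b _ close; apply/orP; left.
  apply/existsP; exists a0; rewrite a0A /=; apply: (@near_leq _ _ _ 0) => //.
  exact/eqP/FN.
case: (ex_minnP (ex_intro close N closeN)) => [[|t] ct tmin].
  case/hasP: ct => x xb /existsP[a /andP[aA /(near_injective F0) xa]].
  by have := bA x xb; rewrite xa inE aA.
have tN : t < N := tmin _ closeN.
have farb x a : x \in b -> a \in A -> ~~ near e (F t) s x a.
  move=> xb aA; apply/negP=> n; suff /tmin : close t by rewrite ltnn.
  by apply/hasP; exists x => //; apply/existsP; exists a; rewrite aA.
case/hasP: ct => b1 b1b /existsP[a /andP[aA nb1a]].
have [[r c] zZ /= [tr Frc Mrc]] := HZ t a aA tN.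
have cA : c \in A := ZA _ zZ.
have [_ /(_ t) Hw] := HRz (r, c) cA.
have nr i x y : near e (F t.+1) i x y -> near e (F r) i x y by apply: (coarsening_near Fc tr).
have ncb1 : near e (F r) s c b1.
  by rewrite (near_eq e s Frc (erefl (F r b1))) (nearC es); apply: nr.
have [j jm annj] := empty_annulus e (F r) b1 b 0 rho; rewrite bm in jm.
pose inner := near e (F r) (0 + j * rho) b1.
(* Masking the outer coordinates by [b1] keeps all of [w] close to [c]. *)
pose w := [seq if inner x then x else b1 | x <- b].
have [||||w' [w'm w'R Gw]] := Hw w.
- exact: ltnW.
(* The neighbours of [c] at time [r] are those of [a] at time [t.+1]; they meet few blocks then, and
   at most twice as many at time [t]. *)
- rewrite Mrc; apply: leq_trans (card_imset_coarsening Fc _ _) _; rewrite leq_mul2l /=.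
  apply: leq_trans (card_near L a (Fw t.+1)).
  by apply/subset_leq_card/imsetS/subsetP=> x; rewrite !inE => /andP[].
- by rewrite size_map.
- move=> x xw.
  have [xb xi] : x \in b /\ inner x.
    case/mapP: xw => y yb ->; case: ifP => // _; split=> //; exact: near_refl.
  split=> [|a' a'A]; last exact: farb.
  apply: near_leq (near_trans ncb1 xi).
  by rewrite leq_add2l leq_mul2r (leq_trans jm) ?orbT.
pose b' := [seq if inner q.1 then q.2 else q.1 | q <- zip b w'].
have b'm : size b' = m.+1 by rewrite size_map size_zip bm w'm minnn.
exists b'; split=> // [|u ul uA].
  have [i ib b1i] : exists2 i, i < size b & nth b1 b i = b1 by apply/(nthP b1).
  apply/(has_nthP b1); exists i; first by rewrite b'm -bm.
  rewrite (nth_map (b1, b1)) ?size_zip ?bm ?w'm ?minnn -?bm // nth_zip ?bm ?w'm //= b1i.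
  rewrite /inner near_refl inE; apply/orP; right; apply/bigcupP; exists (r, c) => //.
  by apply/w'R/mem_nth; rewrite w'm -bm.
(* For the given [u] a second, narrower annulus separates what is close to [b1],
   to which [Gw] applies, from the rest, which is kept fixed. *)
have [i iu anni] := empty_annulus e (F r) b1 u (j * rho) s; rewrite ul in iu.
pose mid := near e (F r) (j * rho + i * s) b1.
have imid x : inner x -> mid x by apply: near_leq; rewrite add0n leq_addr.
(* Entries are masked again, now by [c], since [Gw] accepts only [l]-tuples of neighbours of [c]. *)
pose v := [seq if mid x then x else c | x <- u].
have isl : i.+1 * s <= rho by rewrite leq_mul2r ltnS iu orbT.
have vB : {subset v <= neighbors e F A L r c}.
  move=> x /mapP[y yu ->]; case: ifP => my; rewrite inE ?cA ?near_refl // uA //=.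
  apply: near_leq (near_trans ncb1 my); rewrite leq_add2l mulSnr leq_add //.
    by rewrite leq_mul2r jm orbT.
  by apply: leq_trans isl; rewrite leq_mul2r leqnSn orbT.
have {}Gw := Gw v _ vB; rewrite size_map in Gw; have {}Gw := Gw ul.
apply: game_refines (_ : game e (F r) k _).
  by apply: (coarsening_refines Fc); rewrite -ltnS.
pose z1 := [seq p <- zip (w ++ v) (w' ++ v) | mid p.1].
pose z2 := [seq (x, x) | x <- b ++ u & ~~ near e (F r) (j * rho + i.+1 * s) b1 x].
apply: (@game_sub _ _ _ _ _ (z1 ++ z2)); last first.
  apply: game_cat => //.
  - by apply: game_sub Gw; apply: mem_subseq; apply: filter_subseq.
  - by apply: game_id => p /mapP[x _ ->].
  move=> p q; rewrite mem_filter => /andP[mp _] /mapP[x + ->] /=.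
  rewrite mem_filter => /andP[+ _]; apply: contra => px.
  apply: near_leq (near_trans mp px); by rewrite mulSnr addnA.
move=> p; rewrite zip_cat ?bm // !mem_cat => /orP[pb|pu]; last first.
  move: pu; rewrite mem_zip_diag; case: p => x y /= /andP[/eqP <- xu].
  case: (boolP (mid x)) => mx; apply/orP; [left|right].
    rewrite mem_filter mx zip_cat ?size_map ?bm ?w'm // mem_cat mem_zip_diag eqxx /=.
    by apply/orP; right; apply/mapP; exists x; rewrite // mx.
  apply/mapP; exists x => //; rewrite mem_filter mem_cat xu orbT andbT.
  by apply: contra mx; apply: anni.
have pb1 := mem_zip_fst pb.
have := mem_zip_mix b1 (etrans bm (esym w'm)) pb; case: ifP => ip; [move=> H|move/eqP=> H]; apply/orP; [left|right].
  by rewrite mem_filter imid // zip_cat ?size_map ?bm ?w'm // mem_cat H.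
apply/mapP; exists p.1; last by rewrite {2}H; case: (p).
(* A coordinate of [b] outside [inner] is beyond radius [j.+1 * rho], hence beyond the narrower
   annulus. *)
rewrite mem_filter mem_cat pb1 /= andbT; apply/negP=> H2.
have /negP := negbT ip; apply; apply: annj => //.
by apply: near_leq H2; rewrite add0n (mulSnr j rho) leq_add2l.
Qed.

Lemma leq_size_allpairs (S : eqType) (S' S'' : Type) (g : S -> S' -> S'') (s : seq S) (t : S -> seq S') c :
  (forall x, x \in s -> size (t x) <= c) -> size [seq g x y | x <- s, y <- t x] <= size s * c.
Proof.
elim: s => [|x s IH] //= H; rewrite size_cat size_map mulSn leq_add ?H ?mem_head //.
by apply: IH => y ys; rewrite H // inE ys orbT.
Qed.

Lemma sub_zip_insert (T : eqType) (r : T) (s1 s2 t1 t2 u : seq T) :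
  size s1 = size t1 -> size s2 = size t2 ->
  {subset zip ((s1 ++ r :: s2) ++ u) ((t1 ++ r :: t2) ++ u) <=
          zip ((s1 ++ s2) ++ r :: u) ((t1 ++ t2) ++ r :: u)}.
Proof.
move=> st1 st2 p; rewrite -!catA !zip_cat //=; last by rewrite st2.
by rewrite !(mem_cat, inE) => /or4P[] ->; rewrite ?orbT.
Qed.

(** [l] varies for the sake of the induction: the coordinate in [R] is removed from the tuple, added
    to [A] and moved into [u], which grows by one. *)
Lemma tuple_representatives d k m l : exists C, forall (T : finType) (e : rel T),
  symmetric e -> forall F N, coarsening e d F N -> forall A : {set T}, A != set0 ->
  exists2 S : seq (seq T), size S <= C * #|A| ^ m & forall b : seq T, size b = m ->
    exists b', [/\ b' \in S, size b' = m &
      forall u, size u = l -> {subset u <= A} -> game e (F N) k (zip (b ++ u) (b' ++ u))].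
Proof.
elim: m l => [|m IH] l.
  exists 1 => T e es F N Fc A _; exists [:: [::]] => // [[|]] // _.
  by exists [::]; split=> // u _ _; apply: game_id => p; rewrite mem_zip_diag => /andP[/eqP].
have [C1 H1] := exchange d k m l; have [C2 H2] := IH l.+1.
(* There are at most [C1 * #|A|] choices of [r] and [m.+1] positions for it; since [A] is nonempty,
   [#|r |: A|] is at most [2 * #|A|]. *)
exists (C1 * (m.+1 * (C2 * 2 ^ m))) => T e es F N Fc A An.
have [R Rc HR] := H1 T e es F N Fc A An.
have Ap : 0 < #|A| by rewrite card_gt0.
pose good r (S : seq (seq T)) := size S <= C2 * #|r |: A| ^ m /\ forall b, size b = m ->
    exists b', [/\ b' \in S, size b' = m &
      forall u, size u = l.+1 -> {subset u <= r |: A} -> game e (F N) k (zip (b ++ u) (b' ++ u))].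
have [S HS] : exists S, forall r, good r (S r).
  apply: fin_all_exists => r.
  have [|S Sc HS] := H2 T e es F N Fc (r |: A); last by exists S.
  by apply/set0Pn; exists r; rewrite !inE eqxx.
pose ins (p : T * nat) c := take p.2 c ++ p.1 :: drop p.2 c.
exists [seq ins p c | p <- [seq (r, i) | r <- enum R, i <- iota 0 m.+1], c <- S p.1].
  apply: leq_trans (leq_size_allpairs (c := C2 * 2 ^ m * #|A| ^ m) _ _) _.
    move=> p _; have [+ _] := HS p.1 => /leq_trans; apply.
    rewrite -mulnA leq_mul2l -expnMn; apply/orP; right; case: (m) => // m'; rewrite leq_exp2r //.
    by apply: leq_trans (leq_card_setU _ _) _; rewrite cards1 mul2n -addnn leq_add2r.
  rewrite size_allpairs size_iota -cardE expnS.
  by rewrite [leqRHS]mulnACA !mulnA !leq_mul2r Rc !orbT.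
move=> b bm; have [b1 [b1m /hasP[r rb1 rR] G1]] := HR b bm.
pose i := index r b1; have im : i <= m by rewrite -ltnS -b1m index_mem.
have b1E : b1 = take i b1 ++ r :: drop i.+1 b1 by rewrite -drop_index // cat_take_drop.
have ti : size (take i b1) = i by rewrite size_takel // b1m ltnW.
have [_ /(_ (take i b1 ++ drop i.+1 b1))[|c [cS cm G2]]] := HS r.
  by rewrite size_cat ti size_drop b1m subSS subnKC.
have ti' : size (take i c) = i by rewrite size_takel // cm.
exists (ins (r, i) c); split.
- apply/allpairsPdep; exists (r, i), c; split=> //.
  by apply/allpairsP; exists (r, i); rewrite mem_enum mem_iota.
- by rewrite size_cat ti' /= size_drop cm addnS subnKC.
move=> u ul uA; apply: (@game_trans _ _ _ _ _ (b1 ++ u)).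
- by rewrite !size_cat bm b1m.
- by rewrite !size_cat /= size_drop b1m cm ti' addnS subnKC.
- exact: G1.
have /G2 {}G2 : size (r :: u) = l.+1 by rewrite /= ul.
apply: game_sub (G2 _); last first.
  by move=> x; rewrite !inE => /orP[->//|/uA->]; rewrite orbT.
rewrite [in zip (b1 ++ u)]b1E -[in zip _ (c ++ _)](cat_take_drop i c).
by apply: sub_zip_insert; rewrite ?ti ?ti' // !size_drop b1m cm subSS.
Qed.

(** * First-order formulas and contraction sequences *)

Fixpoint quantifier_rank (phi : formula) : nat :=
  match phi with
  | FEq _ _ | FAdj _ _ | FTrue => 0
  | FNot g => quantifier_rank g
  | FAnd g h | FOr g h => maxn (quantifier_rank g) (quantifier_rank h)
  | FExists _ g | FForall _ g => (quantifier_rank g).+1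
  end.

Definition matched (T : eqType) (z : seq (T * T)) (o o' : option T) :=
  match o, o' with
  | Some a, Some a' => (a, a') \in z
  | None, None => true
  | _, _ => false
  end.

(** This is the direction of the Ehrenfeucht-Fraisse theorem from games to formulas. Variables
    unassigned on both sides do no harm, since they make atoms false alike. *)
Lemma sat_game (T : finType) (e : rel T) f k z phi v v' :
  quantifier_rank phi <= k -> game e f k z -> (forall j, matched z (v j) (v' j)) ->
  sat e v phi = sat e v' phi.
Proof.
elim: phi k z v v' => [i j|i j||g IH|g IHg h IHh|g IHg h IHh|i g IH|i g IH] k z v v' //=.
- move=> _ /game_atom G M; move: (M i) (M j) => /=.
  case: (v i) (v' i) (v j) (v' j) => [a|] [a'|] [b|] [b'|] //= az bz.
  by have [] := G _ _ az bz.
- move=> _ /game_atom G M; move: (M i) (M j) => /=.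
  case: (v i) (v' i) (v j) (v' j) => [a|] [a'|] [b|] [b'|] //= az bz.
  by have [] := G _ _ az bz.
- by move=> qk G M; rewrite (IH _ _ _ _ qk G M).
- by rewrite geq_max => /andP[gk hk] G M; rewrite (IHg _ _ _ _ gk G M) (IHh _ _ _ _ hk G M).
- by rewrite geq_max => /andP[gk hk] G M; rewrite (IHg _ _ _ _ gk G M) (IHh _ _ _ _ hk G M).
all: case: k => // k qk [G1 G2] M.
all: have ext a a' : game e f k ((a, a') :: z) ->
  sat e (fun j => if j == i then Some a else v j) g = sat e (fun j => if j == i then Some a' else v' j) g.
- move=> G; apply: IH qk G _ => j; case: ifP => _ /=; first by rewrite mem_head.
  by move: (M j); rewrite /matched; case: (v j) (v' j) => [x|] [y|] //= xy; rewrite inE xy orbT.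
- apply/existsP/existsP => -[a Ha].
    by have [a' /ext E] := G1 a; exists a'; rewrite -E.
  by have [a' /ext E] := G2 a; exists a'; rewrite E.
- move=> G; apply: IH qk G _ => j; case: ifP => _ /=; first by rewrite mem_head.
  by move: (M j); rewrite /matched; case: (v j) (v' j) => [x|] [y|] //= xy; rewrite inE xy orbT.
apply/forallP/forallP => Ha a.
  by have [a' /ext <-] := G2 a.
by have [a' /ext ->] := G1 a.
Qed.

(** The explicit form of [pblock Q] yields both refinement and the bound of two old parts within a
    new one. *)
Lemma merge_step_pblock (T : finType) (P Q : {set {set T}}) :
  partition P setT -> merge_step P Q -> partition Q setT /\ exists X Y, forall v,
    pblock Q v = if (pblock P v == X) || (pblock P v == Y) then X :|: Y else pblock P v.
Proof.
move=> Ppart /exists_inP[X XP /exists_inP[Y YP /andP[XY /eqP QE]]].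
have /and3P[/eqP Pc Pt P0] := Ppart.
have mQ B : (B \in Q) = (B == X :|: Y) || [&& B != Y, B != X & B \in P] by rewrite QE !inE.
have disj B : B \in P -> B != X -> B != Y -> [disjoint B & X :|: Y].
  move=> BP BX BY; rewrite -setI_eq0 setIUr setU_eq0 !setI_eq0.
  by rewrite !(trivIsetP Pt).
have Qt : trivIset Q.
  apply/trivIsetP=> B B'; rewrite !mQ => /orP[/eqP->|/and3P[BY BX BP]] /orP[/eqP->|/and3P[B'Y B'X B'P]].
  - by rewrite eqxx.
  - by move=> _; rewrite disjoint_sym disj.
  - by move=> _; rewrite disj.
  - exact: (trivIsetP Pt).
have inP v : pblock P v \in P by rewrite pblock_mem // Pc.
have vin v : v \in pblock P v by rewrite mem_pblock Pc.
pose Z v := if (pblock P v == X) || (pblock P v == Y) then X :|: Y else pblock P v.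
have ZQ v : Z v \in Q.
  rewrite /Z mQ; case: ifP; first by rewrite eqxx.
  by move/negbT; rewrite negb_or => /andP[-> ->]; rewrite inP orbT.
have vZ v : v \in Z v.
  rewrite /Z; case: ifP => // /orP[] /eqP <-; by rewrite inE vin ?orbT.
split; last by exists X, Y => v; apply: (def_pblock Qt (ZQ v) (vZ v)).
apply/and3P; split=> //.
  rewrite eqEsubset subsetT; apply/subsetP=> v _; apply/bigcupP; by exists (Z v).
rewrite mQ negb_or; apply/andP; split; last by rewrite (negbTE P0) !andbF.
apply: contraNneq P0 => /eqP; rewrite eq_sym setU_eq0 => /andP[/eqP X0 _].
by rewrite -X0.
Qed.

Lemma singletons_partition (T : finType) : partition (singletons T) setT.
Proof.
apply/and3P; split.
- rewrite eqEsubset subsetT; apply/subsetP=> v _; apply/bigcupP; exists [set v]; rewrite ?set11 //.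
  exact: imset_f.
- apply/trivIsetP=> _ _ /imsetP[u _ ->] /imsetP[v _ ->] uv; rewrite disjoints1 inE.
  by apply: contraNneq uv => ->.
by apply/imsetP=> -[v _ /setP/(_ v)]; rewrite !inE eqxx.
Qed.

Lemma pblock_width (T : finType) (e : rel T) d (P : {set {set T}}) :
  partition P setT -> width_le e d P -> width_at_most e (pblock P) d.
Proof.
move=> /and3P[/eqP Pc Pt _] /forall_inP Pd u.
have blockE v : block (pblock P) v = pblock P v.
  by apply/setP=> x; rewrite !inE eq_sym eq_pblock // Pc.
have inP v : pblock P v \in P by rewrite pblock_mem // Pc.
apply: leq_trans (_ : #|pblock P u |: [set Y in P | (Y != pblock P u) && impure e (pblock P u) Y]| <= _).
  apply/subset_leq_card/subsetP=> _ /imsetP[v + ->]; rewrite !inE /adj !blockE eq_sym inP /=.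
  by case: eqP.
by rewrite cardsU1 -add1n leq_add // ?leq_b1 // (Pd _ (inP u)).
Qed.

Lemma contraction_coarsening (T : finType) (e : rel T) d : tww_le e d ->
  exists F N, coarsening e d F N.
Proof.
case=> s [/andP[spath slast] /allP swidth].
(* The default of [nth] makes the sequence constant after its end. *)
pose P t := nth (last (singletons T) s) (singletons T :: s) t.
have Pend t : size s <= t -> P t = last (singletons T) s.
  rewrite leq_eqVlt => /orP[/eqP<-|lt]; first by rewrite /P nth_last.
  by rewrite /P nth_default.
have Pstep t : t < size s -> merge_step (P t) (P t.+1).
  by move=> ts; apply: (pathP _ spath).
have Ppart t : partition (P t) setT.
  elim: t => [|t IH]; first exact: singletons_partition.
  case: (ltnP t (size s)) => ts; first by have [] := merge_step_pblock IH (Pstep _ ts).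
  by rewrite (Pend _ (leqW ts)) -(Pend _ ts).
exists (fun t => pblock (P t)), (size s); split.
- move=> u v; have P0E w : pblock (P 0) w = [set w].
    have /and3P[_ Pt _] := Ppart 0.
    by apply: def_pblock; rewrite ?set11 //; apply: imset_f.
  by rewrite !P0E; exact: set1_inj.
- move=> t u v uv; case: (ltnP t (size s)) => ts.
    have [_ [X [Y HQ]]] := merge_step_pblock (Ppart t) (Pstep _ ts).
    by rewrite !HQ uv.
  by rewrite (Pend _ (leqW ts)) -(Pend _ ts).
- move=> t; apply: pblock_width (Ppart t) (swidth _ _).
  case: (ltnP t (size s).+1) => ts; first exact: mem_nth.
  by rewrite (Pend _ (ltnW ts)) mem_last.
- move=> t u; case: (ltnP t (size s)) => ts.
    have [_ [X [Y HQ]]] := merge_step_pblock (Ppart t) (Pstep _ ts).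
    have /and3P[/eqP Pc Pt _] := Ppart t.
    have inb w : w \in pblock (P t) w by rewrite mem_pblock Pc.
    pose XY w := (pblock (P t) w == X) || (pblock (P t) w == Y).
    have sub w : XY w -> {subset pblock (P t) w <= X :|: Y}.
      by case/orP=> /eqP-> x xin; rewrite inE xin ?orbT.
    apply: (@leq_trans #|if XY u then [set X; Y] else [set pblock (P t) u]|); last first.
      by case: ifP; rewrite ?cards1 // cards2; case: (X != Y).
    apply/subset_leq_card/subsetP=> _ /imsetP[v + ->]; rewrite inE !HQ -!/(XY _).
    case: ifP => vXY; case: ifP => uXY /eqP E; rewrite !inE //.
      by apply/eqP/(same_pblock Pt); rewrite -E (sub v).
    + have : pblock (P t) u = pblock (P t) v.
        by apply: (same_pblock Pt); rewrite E (sub u).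
      by move=> uv; rewrite -uv; exact: uXY.
    by rewrite E.
  rewrite (Pend _ (leqW ts)) -(Pend _ ts).
  apply: (@leq_trans #|[set pblock (P t) u]|); last by rewrite cards1.
  by apply/subset_leq_card/subsetP=> _ /imsetP[v + ->]; rewrite !inE.
move=> u v; move: slast; rewrite -(Pend (size s) (leqnn _)) => /card_le1_eqP; apply.
  all: have /and3P[/eqP Pc _ _] := Ppart (size s); by rewrite pblock_mem // Pc.
Qed.

Theorem theorem1p3 (d : nat) (phi : formula) (x y : seq nat) :
  uniq x -> uniq y -> all (fun v => v \notin y) x ->
  {subset fv phi <= x ++ y} ->
  exists C : nat,
    forall (T : finType) (e : rel T),
      symmetric e -> irreflexive e -> tww_le e d ->
      forall A : {set T}, A != set0 ->
        #|stone e phi x y A| <= C * #|A| ^ size y.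
Proof.
move=> _ _ _ _.
have [C HC] := tuple_representatives d (quantifier_rank phi) (size y) (size x).
exists C => T e es _ /contraction_coarsening[F [N Fc]] A An.
have [S Sc HS] := HC T e es F N Fc A An.
have [t0 _] := set0Pn _ An.
(* The default [t0] exists because [A] is nonempty, and matters only for sequences in [S] that are
   too short. *)
pose tup (c : seq T) : {ffun 'I_(size y) -> T} := [ffun i : 'I_(size y) => nth t0 c i].
pose st (b : {ffun 'I_(size y) -> T}) := [set a : {ffun 'I_(size x) -> T} |
  [forall i, a i \in A] && sat e (@env T x y a b) phi].
apply: leq_trans Sc.
(* By the game, [b] defines the same set as its representative, so the sequences in [S] account for
   the whole Stone space. *)
apply: (@leq_trans #|[set X in [seq st (tup c) | c <- S]]|); last first.
  by rewrite cardsE; apply: leq_trans (card_size _) _; rewrite size_map.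
apply/subset_leq_card/subsetP=> _ /imsetP[b _ ->]; rewrite inE.
pose bs := [seq b i | i <- enum 'I_(size y)].
have bsz : size bs = size y by rewrite size_map size_enum_ord.
have [c [cS csz G]] := HS bs bsz.
apply/mapP; exists c => //; apply/setP=> a; rewrite !inE.
case: (boolP [forall i, a i \in A]) => //= /forallP aA.
pose u := [seq a i | i <- enum 'I_(size x)].
apply: (sat_game (leqnn _) (G u _ _)).
- by rewrite size_map size_enum_ord.
- by move=> _ /mapP[i _ ->].
move=> j; rewrite /env; case: pickP => [i _|_] /=.
  rewrite zip_cat ?bsz // mem_cat mem_zip_diag eqxx /=.
  by rewrite map_f ?mem_enum ?orbT.
case: pickP => [i _|_] //=; rewrite zip_cat ?bsz // mem_cat ffunE; apply/orP; left.
have -> : b i = nth t0 bs i by rewrite (nth_map i) ?size_enum_ord // nth_ord_enum.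
by rewrite -nth_zip ?bsz // mem_nth // size_zip bsz csz minnn.
Qed.
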